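(* Let $S$ be a countable scattered chain whose Hausdorff rank satisfies $r_H(S) \ge \omega$. Then $T(n, S) = \infty$ for every integer $n$ with $2 \le n < \omega$.
   Context: A chain is a strictly linearly ordered set. A chain is scattered if $\mathbb{Q}$ does not embed into it. Hausdorff rank: for a chain $A$ and chains $B_a$ ($a \in A$), $\sum_{a \in A} B_a$ is the set $\bigcup_{a \in A} (\{a\} \times B_a)$ ordered lexicographically. Let $\mathcal{H}_0$ consist of the empty chain and the one-element chain, and for an ordinal $\alpha > 0$ let $\mathcal{H}_\alpha = \{\sum_{i \in \mathbb{Z}} S_i : S_i \in \bigcup_{\beta<\alpha} \mathcal{H}_\beta \text{ for all } i \in \mathbb{Z}\}$ (chains are considered up to order-isomorphism). Every countable scattered chain $S$ belongs to some $\mathcal{H}_\alpha$ (Hausdorff); $r_H(S)$ is the least such $\alpha$. Big Ramsey degree: an integer $n \ge 1$ is identified with the chain $0<1<\dots<n-1$, and $\mathrm{Emb}(n, C)$ is the set of all order embeddings of $n$ into a chain $C$. $T(n, C)$ is the least integer $t \ge 1$ such that for every integer $k \ge 2$ and every coloring $\chi : \mathrm{Emb}(n, C) \to \{0,\dots,k-1\}$ there is a $U \subseteq C$ order-isomorphic to $C$ with $|\chi(\mathrm{Emb}(n, U))| \le t$; if no such $t$ exists, $T(n, C) = \infty$. *)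

(* Defs.v *)
(* A chain is an [orderType].  The classical layer of MathComp-Analysis is
   used, under which every strict linear order carries such a structure. *)
From HB Require Import structures.
From mathcomp Require Import all_boot all_order all_algebra.
From mathcomp Require Import boolp classical_sets functions cardinality wochoice.

Set Implicit Arguments.
Unset Strict Implicit.
Unset Printing Implicit Defensive.

Import Order.TTheory.
Local Open Scope order_scope.
Local Open Scope classical_set_scope.
Local Open Scope card_scope.

Definition order_embedding d d' (A : orderType d) (B : orderType d')
    (f : A -> B) : Prop :=
  {mono f : x y / x < y}.

Definition order_isomorphic d d' (A : orderType d) (B : orderType d') : Prop :=
  exists2 f : A -> B, order_embedding f & bijective f.

Definition scattered d (A : orderType d) : Prop :=
  ~ exists f : rat -> A, order_embedding f.

(* Ordinals are represented by well-ordered types.  The ordinals strictly below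
   [a] are, up to isomorphism, the initial segments [ord_seg x] for [x : a]. *)
Record ordnum := OrdNum {
  ord_disp : Order.disp_t;
  ord_type :> orderType ord_disp;
  ord_wo : @well_order ord_type <=%O
}.

Section Segment.
Variables (a : ordnum) (x : a).

Definition seg : Type := {y : a | y < x}.

HB.instance Definition _ := SubChoice.on seg.
HB.instance Definition _ := [SubChoice_isSubOrder of seg by <: with ord_disp a].

Lemma seg_wo : @well_order seg <=%O.
Proof.
apply: antisymmetric_well_order; first exact: le_anti.
move=> A [y0 Ay0].
pose B : {pred a} := [pred z | `[< exists2 y : seg, y \in A & val y = z >]].
have [|z [[Bz lbz] _]] := @ord_wo a B.
  by exists (val y0); apply/asboolP; exists y0.
have /asboolP[y Ay yz] := Bz.
exists y; split=> // t At; change (val y <= val t); rewrite yz; apply: lbz.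
by apply/asboolP; exists t.
Qed.

Definition ord_seg : ordnum := OrdNum seg_wo.

End Segment.

(* [a <= b] as ordinals: [a] is isomorphic to an initial segment of [b]. *)
Definition ord_le (a b : ordnum) : Prop :=
  exists2 f : a -> b, order_embedding f &
    forall (x : a) (y : b), y < f x -> exists z : a, f z = y.

Lemma nat_wo : @well_order nat <=%O.
Proof.
apply: antisymmetric_well_order; first exact: le_anti.
move=> A exA; case: (ex_minnP exA) => m Am min_m.
by exists m; split=> // n An; apply: min_m.
Qed.

Definition ord_omega : ordnum := OrdNum nat_wo.

(* [hausdorff a C]: the chain [C] belongs to the class H_a.  The type
   [{i : int & S i}] carries the library's lexicographic order.  The second
   constructor forces [a > 0], since [int] is inhabited. *)
Inductive hausdorff : ordnum -> forall d, orderType d -> Prop :=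
| Hausdorff0 (a : ordnum) d (C : orderType d) :
    (a -> False) -> (forall x y : C, x = y) -> hausdorff a C
| HausdorffSum (a : ordnum) d (C : orderType d)
    d' (S : int -> orderType d') :
    (forall i : int, exists b : a, hausdorff (ord_seg b) (S i)) ->
    order_isomorphic C {i : int & S i} -> hausdorff a C.

(* [hausdorff_rank C a]: r_H(C) = a. *)
Definition hausdorff_rank d (C : orderType d) (a : ordnum) : Prop :=
  hausdorff a C /\ forall b : ordnum, hausdorff b C -> ord_le a b.

Section BigRamsey.
Variables (n : nat) (d : Order.disp_t) (C : orderType d).

Definition Emb : Type := {e : 'I_n -> C | order_embedding e}.

Definition Emb_in (U : set C) : set Emb :=
  [set e | forall i, U (sval e i)].

Definition copy (U : set C) : Prop :=
  exists2 g : C -> C, order_embedding g & range g = U.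

Definition big_ramsey_bound (t : nat) : Prop :=
  (1 <= t)%N /\
  forall k : nat, (2 <= k)%N -> forall chi : Emb -> 'I_k,
    exists2 U : set C, copy U & chi @` Emb_in U #<= `I_t.

(* T(n, C), with [None] for infinity. *)
Definition big_ramsey_degree : option nat :=
  if pselect (exists t, `[< big_ramsey_bound t >]) is left ex_t
  then Some (ex_minn ex_t) else None.

End BigRamsey.

(* Main.v *)
(** Unfolding a derivation of [hausdorff a S] labels the points of S by finite
    sequences of integers, i.e. by leaves of a well-founded tree ordered
    lexicographically.  If a subset U of S has no node from which one can
    branch infinitely often m times inside U, then U is a finite sum of
    chains of rank at most 2m; hence every copy of a chain of infinite rank
    branches infinitely m times, for every m.  Colour a tuple by the number
    modulo t+1 of alternations between the labels of its first and last
    points, where entry j of a label sits at the height obtained by summing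
    absolute values up to j.  Starting from two children of a deep branching
    node, extending the two labels in turn by entries so large that they
    overtake everything chosen so far adds exactly one alternation per round,
    so all t+1 colours occur. *)
From HB Require Import structures.
Require Import Defs.
From mathcomp Require Import all_boot all_order all_algebra.
From mathcomp Require Import zify.
From mathcomp Require Import boolp classical_sets functions cardinality.

Set Implicit Arguments.
Unset Strict Implicit.
Unset Printing Implicit Defensive.

Import Order.TTheory.

(** * Alternations of increasing sequences, and codes of integer words *)

(* For increasing [X] and [Y]: the number of [v] in [Y] such that some element
   of [X] lies strictly between the predecessor of [v] in [Y] and [v]. *)
Definition osc (X Y : seq nat) : nat :=
  count (fun v =>
    has (fun u => (u < v) && all (fun z => (z < u) || (v <= z)) Y) X) Y.

(** A separating element must lie strictly below some [v] in [Y]; the elements of [B] are too large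
    for that. *)
Lemma osc_catl X Y B :
  all (fun b => all (fun v => v <= b) Y) B -> osc (X ++ B) Y = osc X Y.
Proof.
move=> /allP hB; apply: eq_in_count => v Yv; rewrite has_cat.
rewrite [X in _ || X](_ : _ = false) ?orbF //; apply/negbTE/hasPn => u Bu.
by rewrite ltnNge (allP (hB u Bu) v Yv).
Qed.

(** Of the new elements only [b] is counted: some element of [X] above all of [Y] separates it from
    [Y], whereas nothing in [X] exceeds [b] to separate the later ones. The old gaps are
    undisturbed, since the new elements lie above [Y]. *)
Lemma osc_catr X Y b B :
  sorted ltn (b :: B) -> all (fun x => x < b) (X ++ Y) ->
  has (fun u => all (fun z => z < u) Y) X -> osc X (Y ++ b :: B) = (osc X Y).+1.
Proof.
rewrite all_cat => sB /andP[/allP Xb /allP Yb] topX.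
have Bb z : z \in B -> b < z.
  by move: z; apply/allP/(order_path_min ltn_trans).
rewrite /osc count_cat -addn1; congr (_ + _).
  apply: eq_in_count => v Yv; apply: eq_has => u; congr (_ && _).
  rewrite all_cat [X in _ && X](_ : _ = true) ?andbT //; apply/allP => z.
  rewrite inE => /orP[/eqP -> | /Bb bz]; first by rewrite (ltnW (Yb v Yv)) orbT.
  by rewrite (ltnW (ltn_trans (Yb v Yv) bz)) orbT.
rewrite /= (_ : has _ X = true) ?add1n; last first.
  case/hasP: topX => u Xu /allP uY; apply/hasP; exists u => //.
  rewrite Xb // all_cat /= leqnn orbT /=; apply/andP; split; apply/allP => z.
    by move=> Yz; rewrite uY.
  by move=> Bz; rewrite (ltnW (Bb z Bz)) orbT.
congr _.+1; apply/eqP; rewrite -leqn0 leqNgt -has_count.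
apply/hasPn => v Bv; apply/hasPn => u Xu; rewrite all_cat /=.
have /negbTE -> : ~~ ((b < u) || (v <= b)) by rewrite negb_or -leqNgt (ltnW (Xb u Xu)) -ltnNge (Bb v Bv).
by rewrite andFb !andbF.
Qed.

Notation weight := (scanl (fun (n : nat) (i : int) => (n + absz i).+1)).

(** The successor in [weight] keeps the partial sums strictly increasing across zero entries. *)
Definition codes (w : seq int) : seq nat := weight 0 w.

Lemma weight_sorted n w : path ltn n (weight n w).
Proof. by elim: w n => //= i w IH n; rewrite IH andbT ltnS leq_addr. Qed.

Lemma codes_cat w (i : int) s : exists b B,
  [/\ codes (w ++ i :: s) = codes w ++ b :: B, sorted ltn (b :: B) & absz i < b].
Proof.
rewrite /codes scanl_cat /=; set n := foldl _ _ _.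
exists (n + absz i).+1, (weight (n + absz i).+1 s).
by split=> //; [apply: weight_sorted | rewrite ltnS leq_addl].
Qed.

(** * Infinitely branching nodes in a set of integer words *)

Section Nodes.
Local Open Scope classical_set_scope.

(* From [p] one can choose, [m] times in a row, among infinitely many children;
   the segment after each choice is forced. *)
Fixpoint node (W : set (seq int)) (m : nat) (p : seq int) : Prop :=
  if m is m'.+1 then infinite_set [set i | exists s, node W m' (p ++ i :: s)]
  else W p.

Lemma node_cons (W : set (seq int)) i m p :
  node [set w | W (i :: w)] m p -> node W m (i :: p).
Proof.
elim: m p => //= m IH p; apply: sub_infinite_set => j [s /IH]; by exists s.
Qed.

Lemma infinite_int_large (A : set int) b :
  infinite_set A -> exists2 i, A i & b < absz i.
Proof.
move=> infA; apply: contrapT => small; apply: infA.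
apply: (@sub_finite_set _ _
  ([set Posz k | k in `I_b.+1] `|` [set (- Posz k)%R | k in `I_b.+1])).
  move=> i Ai; have ib : absz i <= b.
    by rewrite leqNgt; apply/negP => bi; apply: small; exists i.
  case: i Ai ib => k _ kb; [left | right].
    by exists k.
  by exists k.+1.
by rewrite finite_setU; split; apply: finite_image; apply: finite_II.
Qed.

Lemma node_descend W m j p : j <= m -> node W m p -> exists s, node W j (p ++ s).
Proof.
elim: m p => [|m IH] p; first by rewrite leqn0 => /eqP -> Np; exists [::]; rewrite cats0.
rewrite leq_eqVlt => /orP[/eqP -> Np|jm /infinite_setN0[i [s Ns]]].
  by exists [::]; rewrite cats0.
by have [r Nr] := IH _ jm Ns; exists (i :: s ++ r); move: Nr; rewrite -catA.
Qed.

Lemma node_fresh W m j p c : j <= m -> node W m.+1 p ->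
  exists r b B, [/\ node W j (p ++ r), codes (p ++ r) = codes p ++ b :: B,
                    sorted ltn (b :: B) & c < b].
Proof.
move=> jm /(infinite_int_large c)[i [s Ns] ci].
have [s' Ns'] := node_descend jm Ns.
have [b [B [eB sB ib]]] := codes_cat p i (s ++ s').
exists (i :: s ++ s'), b, B; split=> //; last exact: ltn_trans ib.
by move: Ns'; rewrite -catA.
Qed.

Lemma seq_bound (s : seq nat) : exists c, forall x, x \in s -> x <= c.
Proof.
exists (\max_(x <- s) x) => x xs; exact: (@leq_bigmax_seq _ s predT (fun x => x)).
Qed.

(** First [p] is extended beyond all codes of [q], which leaves [osc] unchanged; then [q] is
    extended beyond everything, which adds exactly one. *)
Lemma node_round W m j p q : j <= m -> node W m.+1 p -> node W m.+1 q ->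
  exists r r', [/\ node W j (p ++ r), node W j (q ++ r') &
    osc (codes (p ++ r)) (codes (q ++ r')) = (osc (codes p) (codes q)).+1].
Proof.
move=> jm Np Nq.
have [c hc] := seq_bound (codes q).
have [r [b [B [Nr eB sB cb]]]] := node_fresh c jm Np.
have [c' hc'] := seq_bound (codes (p ++ r) ++ codes q).
have [r' [b' [B' [Nr' eB' sB' cb']]]] := node_fresh c' jm Nq.
exists r, r'; split=> //; rewrite eB' osc_catr //.
- rewrite eB osc_catl //; apply/allP => x; rewrite inE => Bx; apply/allP => v /hc vc.
  apply: leq_trans vc _; apply: ltnW; apply: leq_trans cb _; case/orP: Bx => [/eqP -> //|Bx].
  by apply: ltnW; apply: (allP (order_path_min ltn_trans sB)).
- by apply/allP => x /hc' /leq_ltn_trans; apply.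
- apply/hasP; exists b; first by rewrite eB mem_cat inE eqxx orbT.
  by apply/allP => z /hc /leq_ltn_trans; apply.
Qed.

Lemma node_osc W m p q k : k <= m -> node W m.+1 p -> node W m.+1 q ->
  exists r r', [/\ W (p ++ r), W (q ++ r') &
    osc (codes (p ++ r)) (codes (q ++ r')) = osc (codes p) (codes q) + k.+1].
Proof.
elim: k m p q => [|k IH] m p q km Np Nq.
  have [r [r' [Wr Wr' e]]] := node_round km Np Nq.
  by exists r, r'; split; rewrite ?addn1.
case: m km Np Nq => // m km Np Nq.
have [r [r' [Nr Nr' e]]] := node_round (leqnn m.+1) Np Nq.
have [s [s' [Ws Ws' e']]] := IH m _ _ km Nr Nr'.
by exists (r ++ s), (r' ++ s'); rewrite !catA; split; rewrite // e' e addSnnS.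
Qed.

End Nodes.

(** * Finite Hausdorff ranks of subsets and their finite sums *)

Section Ranks.
Local Open Scope classical_set_scope.

(** For [m > 0] this amounts to [a] being at least [m]; for [m = 0] it forces [a] to be empty. The
    recursion mirrors the descent to [ord_seg b] in [hausdorff]. *)
Fixpoint height (a : ordnum) (m : nat) : Prop :=
  if m is m'.+1 then exists b : a, height (ord_seg b) m' else a -> False.

Lemma initial_height (a : ordnum) m (f : a -> nat) :
  order_embedding f -> (forall k, k < m <-> exists x, f x = k) -> height a m.
Proof.
elim: m a f => [|m IH] a f fM im /=.
  by move=> x; have /im : exists y, f y = f x by exists x.
have /im [b fb] : m < m.+1 by [].
exists b; apply: (IH (ord_seg b) (fun y : seg b => f (val y))) => [x y|k]; first exact: fM.
split=> [km|[x <-] /=]; last by rewrite -fb; have := valP x; rewrite -fM.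
have /im [x fx] : k < m.+1 by apply: ltnW.
have xb : (x < b)%O by rewrite -fM fx fb.
by exists (exist _ x xb).
Qed.

Variables (d : Order.disp_t) (X : orderType d).
Implicit Types (U V : set X) (F : int -> set X).

Definition below U V := forall x y, U x -> V y -> (x < y)%O.

Definition ordered F := forall i j, (i < j)%O -> below (F i) (F j).

(* Ranging over all presentations [h] of [U] spares transporting [hausdorff]
   along isomorphisms. *)
Definition rank_le m U := forall a d' (D : orderType d') (h : D -> X),
  order_embedding h -> range h = U -> height a m -> hausdorff a D.

Local Notation chain U := {x : X | x \in U}.

HB.instance Definition _ U := SubChoice.on (chain U).
HB.instance Definition _ U := [SubChoice_isSubOrder of chain U by <: with d].

Lemma embedding_inj d1 d2 (A : orderType d1) (B : orderType d2) (f : A -> B) :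
  order_embedding f -> injective f.
Proof.
move=> fM x y; case: (ltgtP x y) => // + e; rewrite -fM e ltxx //.
Qed.

(** Since the pieces are stacked in order, the index of a point is unique and monotone; pairing each
    point with its index gives the isomorphism with the lexicographic sum. *)
Lemma rank_le_sum m F : ordered F -> (forall i, rank_le m (F i)) ->
  rank_le m.+1 (\bigcup_i F i).
Proof.
move=> oF rF a d' D h hM im [b hb].
pose S i : orderType d := chain (F i).
apply: (@HausdorffSum a _ D _ S).
  move=> i; exists b; apply: (rF i _ _ _ (fun x : chain (F i) => val x)) => //.
  apply/seteqP; split=> [_ [x _ <-]|x Fx]; first by have := valP x; rewrite inE.
  by exists (exist _ x (mem_set Fx)).
have ix x : exists i, F i (h x).
  by have : range h (h x) by [exists x]; rewrite im => -[i _ ?]; exists i.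
have [f hf] := choice ix.
pose phi x : {i : int & S i} := Tagged S (exist _ (h x) (mem_set (hf x)) : S (f x)).
have phiM : {homo phi : x y / (x < y)%O}.
  move=> x y xy; rewrite Order.SigmaOrder.ltEsig /=.
  have hxy : (h x < h y)%O by rewrite hM.
  case: (ltgtP (f x) (f y)) => // fxy.
    by have := oF _ _ fxy _ _ (hf y) (hf x) => /(lt_trans hxy); rewrite ltxx.
  rewrite /phi /=; move: (hf x) (hf y); rewrite fxy => Fx Fy.
  by rewrite tagged_asE.
have phiM' : {mono phi : x y / (x < y)%O} by apply/leW_mono/le_mono.
exists phi => //.
have psi z : exists x, phi x = z.
  case: z => i z; have Fz : F i (val z) by have := valP z; rewrite inE.
  have : range h (val z) by rewrite im; exists i.
  case=> x _ hx; exists x.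
  have fi : f x = i.
    case: (ltgtP (f x) i) => // lt; have := oF _ _ lt.
      by move/(_ _ _ (hf x) Fz); rewrite hx ltxx.
    by move/(_ _ _ Fz (hf x)); rewrite hx ltxx.
  rewrite /phi; move: (hf x); rewrite fi => Fx.
  by congr existT; apply: val_inj.
have [k kK] := choice psi.
by exists k => // x; apply: (embedding_inj phiM').
Qed.

(** Padding with empty summands lets a set of at most one point climb through all finite ranks. *)
Definition int_seq U : int -> set X := fun i => if i == 0%R then U else set0.

Lemma ordered_int_seq U : ordered (int_seq U).
Proof.
move=> i j ij x y; rewrite /int_seq; case: eqP => // i0; case: eqP => // j0.
by move: ij; rewrite i0 j0 ltxx.
Qed.

Lemma bigcup_int_seq U : \bigcup_i int_seq U i = U.
Proof.
rewrite /int_seq; apply/seteqP; split=> [x [i _]|x Ux]; first by case: eqP.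
by exists 0%R => //; rewrite eqxx.
Qed.

Lemma rank_le_sub1 m U : is_subset1 U -> rank_le m U.
Proof.
elim: m U => [|m IH] U sU.
  move=> a d' D h hM im ha; apply: Hausdorff0 => // x y.
  by apply: (embedding_inj hM); apply: sU; rewrite -im; [exists x|exists y].
rewrite -(bigcup_int_seq U); apply: rank_le_sum; first exact: ordered_int_seq.
by move=> i; rewrite /int_seq; case: eqP => _; apply: IH => // x y.
Qed.

Inductive fsum (K : set (set X)) : set X -> Prop :=
| fsum0 : fsum K set0
| fsumS U V : fsum K U -> K V -> below U V -> fsum K (U `|` V).

Lemma fsum1 (K : set (set X)) U : K U -> fsum K U.
Proof. by move=> KU; rewrite -(set0U U); apply: fsumS => //; apply: fsum0. Qed.

Lemma fsum_cat K U V : fsum K U -> fsum K V -> below U V -> fsum K (U `|` V).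
Proof.
move=> KU; elim=> [|V1 V2 _ IH KV2 V12] UV; first by rewrite setU0.
rewrite setUA; apply: fsumS => //.
  by apply: IH => x y Ux Vy; apply: UV => //; left.
by move=> x y [Ux|V1x] V2y; [apply: UV => //; right | apply: V12].
Qed.

(** The bound [n] keeps an index free for the next summand on the right. *)
Lemma fsum_enum (K : set (set X)) U : K set0 -> fsum K U -> exists F n,
  [/\ forall i, K (F i), ordered F, forall i : int, (n <= i)%O -> F i = set0 &
      \bigcup_i F i = U].
Proof.
move=> K0; elim=> [|{}U V _ [F [n [KF oF F0 FU]]] KV UV].
  by exists (fun=> set0), 0%R; split=> [//|i j _ x y []|//|]; rewrite bigcup0.
have Fb i x : F i x -> U x by rewrite -FU; exists i.
exists (fun i => if i == n then V else F i), (n + 1)%R; split.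
- by move=> i; case: eqP.
- move=> i j; case: eqP => [->|_] => [nj|ij].
    by rewrite gt_eqF // F0 ?ltW.
  by case: eqP => _ x y Fx; [apply: UV; apply: Fb Fx | apply: oF ij _ _ Fx].
- move=> i ni; have {}ni : (n < i)%O by rewrite -lezD1.
  by rewrite gt_eqF // F0 ?ltW.
- rewrite -FU; apply/seteqP; split=> x.
    by case=> i _; case: eqP => _ h; [right | left; exists i].
  case=> [[i _ Fx]|Vx]; last by exists n => //; rewrite eqxx.
  exists i => //; case: eqP => // ni; move: Fx; rewrite F0 //; by rewrite ni.
Qed.

Lemma fsum_rank_le m U : fsum (rank_le m) U -> rank_le m.+1 U.
Proof.
move=> sU; have [|F [n [KF oF _ <-]]] := fsum_enum _ sU; first by apply: rank_le_sub1 => x y [].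
exact: rank_le_sum.
Qed.

(** Each level costs two ranks: one to merge a finite sum into a single chain, one for the sum over
    the integers. *)
Definition fin_rank m := fsum (rank_le m.*2).

Lemma fin_rank_sum m F : ordered F -> (forall i, fin_rank m (F i)) ->
  fin_rank m.+1 (\bigcup_i F i).
Proof.
move=> oF rF; apply: fsum1; rewrite doubleS.
exact: (rank_le_sum oF (fun i => fsum_rank_le (rF i))).
Qed.

Lemma fin_rank_cat m U V :
  fin_rank m U -> fin_rank m V -> below U V -> fin_rank m (U `|` V).
Proof. exact: fsum_cat. Qed.

(* Cutting the sum at an exceptional index leaves two sums with fewer exceptions. *)
Lemma fin_rank_sum_exc m (s : seq int) F : ordered F ->
  (forall i, fin_rank m.+1 (F i)) -> (forall i, i \notin s -> fin_rank m (F i)) ->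
  fin_rank m.+1 (\bigcup_i F i).
Proof.
elim: s F => [|i0 s IH] F oF rF eF.
  by apply: fin_rank_sum => // i; apply: eF.
pose mask (P : pred int) i := if P i then F i else set0.
have oM P : ordered (mask P).
  by move=> i j ij x y; rewrite /mask; case: (P i); case: (P j) => //; apply: oF.
have rM P : ~~ P i0 -> fin_rank m.+1 (\bigcup_i mask P i).
  move=> P0; apply: IH => // i; rewrite /mask; case: ifP => Pi; try by move=> *; apply: fsum0.
    exact: rF.
  move=> si; apply: eF; rewrite inE negb_or si andbT.
  by apply: contraNneq P0 => <-.
have -> : \bigcup_i F i = \bigcup_i mask (fun i => i < i0)%O i `|`
    (F i0 `|` \bigcup_i mask (fun i => i0 < i)%O i).
  rewrite /mask; apply/seteqP; split=> x.
    move=> [i _ Fx]; case: (ltgtP i i0) => ii; last by right; left; rewrite -ii.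
      by left; exists i; rewrite ?ii.
    by right; right; exists i; rewrite ?ii.
  by case=> [[i _]|[Fx|[i _]]]; [|by exists i0|]; case: ifP => // _ Fx; exists i.
apply: fin_rank_cat; first by apply: (rM (fun i => i < i0)%O); rewrite ltxx.
  apply: fin_rank_cat => //; first by apply: (rM (fun i => i0 < i)%O); rewrite ltxx.
  by move=> x y Fx [i _]; rewrite /mask; case: ifP => // ii Fy; apply: oF ii _ _ Fx Fy.
move=> x y [i _]; rewrite /mask; case: ifP => // ii Fx [Fy|[j _]].
  by apply: oF ii _ _ Fx Fy.
by case: ifP => // jj Fy; apply: (oF i j) => //; apply: lt_trans jj.
Qed.

Lemma fin_rank_sub1 m U : is_subset1 U -> fin_rank m U.
Proof. by move=> /rank_le_sub1 h; apply: fsum1; apply: h. Qed.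

End Ranks.

(** * Labels from a derivation, and the branching of copies *)

Section Labelling.
Local Open Scope classical_set_scope.

(** The embedding [g] keeps every summand met in the recursion inside one fixed [X], so that their
    images can be summed there. *)
Lemma hausdorff_label (d : Order.disp_t) (X : orderType d) a d' (C : orderType d')
    (g : C -> X) :
  hausdorff a C -> order_embedding g -> exists L : C -> seq int,
    (forall x y s i j r r', L x = s ++ i :: r -> L y = s ++ j :: r' ->
       (i < j)%O -> (x < y)%O) /\
    (forall V m, ~ (exists p, node (L @` V) m p) -> fin_rank m (g @` V)).
Proof.
(* The subderivations sit under an existential quantifier, so the recursion runs on the derivation
   itself. *)
move=> hC; move: a d' C hC g; fix IH 4 => a d' C [{}a {}d' {}C _ C1|{}a {}d' {}C d1 S hS [f fM [k fk kf]]] g gM.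
  exists (fun=> [::]); split=> [x y [|? ?] ? ? ? ? //|V m _].
  by apply: fin_rank_sub1 => _ _ [x _ <-] [y _ <-]; congr g.
have kM : order_embedding k by move=> x y; rewrite -fM !kf.
have kE x : k (Tagged S (tagged (f x))) = x by rewrite -[RHS]fk; case: (f x).
have iM i : order_embedding (fun x : S i => k (Tagged S x)).
  by move=> x y; rewrite kM Order.SigmaOrder.ltEsig /= lexx tagged_asE.
have hL i : exists L : S i -> seq int,
    (forall x y s i j r r', L x = s ++ i :: r -> L y = s ++ j :: r' ->
       (i < j)%O -> (x < y)%O) /\
    (forall V m, ~ (exists p, node (L @` V) m p) ->
       fin_rank m ((fun x => g (k (Tagged S x))) @` V)).
  case: (hS i) => b hb.
  by apply: (IH _ _ _ hb) => x y; rewrite gM iM.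
pose L i := projT1 (cid (hL i)); pose HL i := projT2 (cid (hL i)).
pose L' (x : C) := tag (f x) :: L (tag (f x)) (tagged (f x)).
exists L'; split=> [x y s i j r r'|V m noV].
  rewrite -fM /L'; case: (f x) (f y) => [i1 x1] [i2 y1] /=.
  case: s => [|i0 s] /= [e1 E1] [e2 E2] ij.
    have {}ij : (i1 < i2)%O by rewrite e1 e2.
    by rewrite Order.SigmaOrder.ltEsig /= ltW //= lt_geF.
  subst i1 i2.
  by rewrite Order.SigmaOrder.ltEsig /= lexx tagged_asE /=; apply: (HL i0).1 E1 E2 ij.
pose W i := [set x : S i | V (k (Tagged S x))].
have WE i : [set w | (L' @` V) (i :: w)] = L i @` W i.
  apply/seteqP; split=> w.
    case=> x Vx; rewrite /L'; case e : (f x) => [i1 x1] /= [ei <-].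
    subst i1; exists x1 => //; by rewrite /W /= -[Tagged _ _]e fk.
  by case=> x Wx <-; exists (k (Tagged S x)) => //; rewrite /L' kf.
pose F i := (fun x => g (k (Tagged S x))) @` W i.
have oF : ordered F.
  move=> i j ij _ _ [x _ <-] [y _ <-].
  by rewrite gM kM Order.SigmaOrder.ltEsig /= ltW //= lt_geF.
have FV : g @` V = \bigcup_i F i.
  apply/seteqP; split=> y.
    case=> x Vx <-; exists (tag (f x)) => //.
    by exists (tagged (f x)); rewrite /W /= kE.
  by case=> i _ [x Wx <-]; exists (k (Tagged S x)).
rewrite {}FV.
have noW i p : ~ node (L' @` V) m (i :: p) -> ~ node (L i @` W i) m p.
  by apply: contra_not; rewrite -WE; apply: node_cons.
have rF i : fin_rank m (F i).
  by apply: (HL i).2 => -[p Np]; apply: noW Np => Np; apply: noV; exists (i :: p).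
case: m => [|m] in noV noW rF *.
  rewrite (_ : \bigcup_i F i = set0); first exact: fsum0.
  rewrite -subset0 => y [i _ [x Wx _]]; apply: noV; exists (L' (k (Tagged S x))).
  by exists (k (Tagged S x)).
(* The root does not branch [m.+1] times, so only finitely many summands contain a node of level
   [m]. These are the exceptions, bounded by [rF]; all others have the smaller bound for [m]. *)
have fin : finite_set [set i | exists s, node (L' @` V) m (i :: s)].
  by apply: contrapT => inf; apply: noV; exists [::].
have /finite_seqP[s es] := fin.
apply: (@fin_rank_sum_exc _ _ m s) => // i si; apply: (HL i).2 => -[p].
rewrite -WE => /node_cons Np; move/negP: si; apply.
have : [set` s] i by rewrite -es; exists p.
by [].
Qed.

(** Otherwise minimality of [r] would embed [r], hence omega, into the ordinal [m]; but a strictly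
    increasing map [e] on the naturals satisfies [k <= e k], which fails the bound at [k = m]. *)
Lemma copy_infinite_rank (r : ordnum) d (C : orderType d) m U :
  hausdorff_rank C r -> ord_le ord_omega r -> copy U -> ~ @rank_le d C m U.
Proof.
move=> [_ minr] [f fM _] [g gM gU] rU; pose a := @ord_seg ord_omega m.
have ha : height a m.
  apply: (@initial_height a _ (fun y : seg (m : ord_omega) => val y : nat)) => // k.
  split=> [km|[x <-]]; last exact: (valP x).
  by exists (exist _ (k : ord_omega) km).
have [h hM _] := minr _ (rU _ _ _ g gM gU ha).
pose e (k : ord_omega) : nat := val (h (f k) : seg (m : ord_omega)).
have eM k l : k < l -> e k < e l.
  by move=> kl; have : (h (f k) < h (f l))%O by rewrite hM fM.
have ge k : k <= e k by elim: k => // k IH; apply: leq_ltn_trans IH (eM _ _ _).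
have em : e m < m := valP (h (f m) : seg (m : ord_omega)).
by have := ge m; rewrite leqNgt em.
Qed.

Lemma infinite_int_sorted (A : set int) n :
  infinite_set A -> exists2 s : seq int, sorted <%O s &
    size s = n /\ forall i, i \in s -> A i.
Proof.
move=> /(infinite_set_fset n)[B BA nB].
exists (take n (sort <=%O (finmap.enum_fset B))).
  apply: take_sorted; rewrite lt_sorted_uniq_le sort_uniq finmap.fset_uniq /=.
  exact: sort_le_sorted.
split; first by rewrite size_takel // size_sort.
by move=> i /mem_take; rewrite mem_sort => Bi; apply: BA.
Qed.

End Labelling.

(** * The colouring and its values on a copy *)

Theorem theorem4p4 (d : Order.disp_t) (S : orderType d) (r : ordnum) (n : nat) :
  countable [set: S]%classic -> scattered S ->
  hausdorff_rank S r -> ord_le ord_omega r ->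
  (2 <= n)%N -> big_ramsey_degree n S = None.
Proof.
move=> _ _ rS wr; case: n => [|[|n]] // _.
rewrite /big_ramsey_degree; case: pselect => // ex_t; exfalso.
case: ex_t => t /asboolP[t1 Ht].
have [L [Lmono Lnode]] := hausdorff_label rS.1 
  (fun x y : S => erefl : (id x < id y)%O = (x < y)%O).
pose c (x y : S) := osc (codes (L x)) (codes (L y)).
have [U Ucopy cardU] := Ht t.+1 t1
  (fun e => inord (c (sval e ord0) (sval e ord_max) %% t.+1)).
(* One level is spent on choosing children of [p], and [t.+1] levels remain for at most [t.+1]
   rounds. *)
have [p /= infp] : exists p, node (L @` U)%classic t.+2 p.
  apply: contrapT => /Lnode; rewrite image_id => /fsum_rank_le.
  exact: copy_infinite_rank rS wr Ucopy.
(* Points placed below distinct children of [p] are ordered like those children, so the outer two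
   can be varied while the inner ones stay fixed. *)
have [s s_lt [sn sA]] := infinite_int_sorted n.+2 infp.
have sN k : k < n.+2 -> exists q, node (L @` U)%classic t.+1 (p ++ nth 0%R s k :: q).
  by move=> kn; apply: sA; rewrite mem_nth ?sn.
have [q0 N0] := sN 0 isT; have [q1 N1] := sN n.+1 (ltnSn _).
set p0 := p ++ _ in N0; set p1 := p ++ _ in N1.
have s_mono k l : k < n.+2 -> l < n.+2 -> k < l -> (nth 0%R s k < nth 0%R s l)%O.
  by move=> kn ln kl; rewrite lt_sorted_ltn_nth ?inE ?sn.
have midP k : exists z, k < n.+2 -> U z /\ exists q, L z = p ++ nth 0%R s k :: q.
  case: (ltnP k n.+2) => kn; last first.
    by case: Ucopy => g _ _; have [_ [z _ _]] := node_descend (leq0n _) N0; exists z.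
  have [q Nq] := sN k kn; have [q' [z Uz Lz]] := node_descend (leq0n _) Nq.
  by exists z => _; split=> //; exists (q ++ q'); rewrite Lz -catA.
have [mid hmid] := choice midP.
have tuple k : k <= t -> exists e : Emb n.+2 S, Emb_in U e /\
    c (sval e ord0) (sval e ord_max) = osc (codes p0) (codes p1) + k.+1.
  move=> kt; have [r0 [r1 [[x Ux Lx] [y Uy Ly] exy]]] := node_osc kt N0 N1.
  pose e (i : 'I_n.+2) := if i == ord0 then x else if i == ord_max then y else mid i.
  have eP i : U (e i) /\ exists q, L (e i) = p ++ nth 0%R s i :: q.
    rewrite /e; case: eqP => [->|_].
      by split=> //; exists (q0 ++ r0); rewrite Lx /p0 -catA.
    case: eqP => [->|_]; last exact: hmid.
    by split=> //; exists (q1 ++ r1); rewrite Ly /p1 -catA.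
  have eM : order_embedding e.
    apply/leW_mono/le_mono => i j ij.
    have [_ [qi Li]] := eP i; have [_ [qj Lj]] := eP j.
    by apply: (Lmono _ _ _ _ _ _ _ Li Lj); apply: s_mono.
  exists (exist _ e eM); split=> [i|]; first exact: (eP i).1.
  by rewrite /= /e !eqxx /c Lx Ly.
move: cardU; set chi := (fun e => _) => cardU.
have : (`I_t.+1 #<= `I_t)%card; last by rewrite card_le_II ltnn.
apply: (card_le_trans _ cardU); apply: card_le_trans (card_image_le (@nat_of_ord _) _).
apply: subset_card_le => j /= jt; set c0 := osc (codes p0) (codes p1) in tuple.
(* The number of rounds is chosen so that the total is congruent to [j]: [c0 + 1 + (j + c0 * t + t)
   = (c0 + 1) * (t + 1) + j]. *)
have [|e [Ue ce]] := tuple ((j + c0 * t + t) %% t.+1); first by rewrite -ltnS ltn_mod.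
exists (chi e); first by exists e.
rewrite /chi inordK ?ltn_mod // ce addnS -addSn modnDmr.
have -> : c0.+1 + (j + c0 * t + t) = c0.+1 * t.+1 + j.
  by lia.
by rewrite modnMDl modn_small.
Qed.
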